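(* For every $d\in\mathbb{N}$, $\beta>0$ and $Q\in\mathbb{N}$ there exist $\epsilon=\epsilon(d,\beta,Q)>0$, $\mu=\mu(d,\beta)>0$ and $\alpha=\alpha(d,\beta)>0$ such that the following holds. Let $X$ be a $d$-complex such that: (i) $\max_{v\in X(0)}|X_v|\le Q$ (here $|X_v|$ is the number of faces of the link $X_v$); (ii) for every $\sigma\in X$ with $1\le|\sigma|\le d-1$, the link $X_\sigma$ is a $\beta$-coboundary expander; (iii) for every $\sigma\in X$ with $0\le|\sigma|\le d-1$, the link $X_\sigma$ is an $\alpha$-skeleton expander (for $\sigma=\emptyset$ this means $X$ itself). Then $Exp_z^k(X)\ge\epsilon$ for every $0\le k\le d-2$, and $Syst^r(X)\ge\mu$ for every $0\le r\le d-1$.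
   Context: A $d$-complex is a finite pure $d$-dimensional simplicial complex $X$; faces are sets of vertices, the empty set is a face (the unique $(-1)$-face), $|\sigma|$ is the number of vertices of $\sigma$ and $\dim\sigma=|\sigma|-1$; $X(k)$ is the set of $k$-faces. $C^k=C^k(X;\mathbb{F}_2)$ is the space of functions $X(k)\to\mathbb{F}_2$, identified with subsets of $X(k)$ (addition is symmetric difference). The coboundary $\delta=\delta^k\colon C^k\to C^{k+1}$ is $(\delta f)(\tau)=\sum_{\sigma\subset\tau,\sigma\in X(k)}f(\sigma)$; $B^k=\mathrm{Im}\,\delta^{k-1}$, $Z^k=\ker\delta^k$. The weight of $\sigma\in X$ is $w(\sigma)=\frac{|\{F\in X(d):\sigma\subset F\}|}{\binom{d+1}{|\sigma|}|X(d)|}$ and the norm of $A\subset X(k)$ is $\|A\|=\sum_{\sigma\in A}w(\sigma)$. For $\sigma\in X$ the link is $X_\sigma=\{\tau\in X:\tau\cap\sigma=\emptyset,\ \tau\cup\sigma\in X\}$, a pure $(d-|\sigma|)$-complex, equipped with its own cochains, coboundary and norm defined by the same recipe (so $X_\emptyset=X$). $Exp_z^k(X)=\min\{\|\delta A\|/\min_{z\in Z^k}\|A+z\| : A\in C^k\setminus Z^k\}$ and $Syst^k(X)=\min\{\|z\|: z\in Z^k\setminus B^k\}$ (with $\min\emptyset=\infty$). A complex $Y$ of dimension $m$ is a $\beta$-coboundary expander if for every $0\le k\le m-1$ and every $A\in C^k(Y)\setminus B^k(Y)$, $\|\delta A\|\ge\beta\cdot\min_{b\in B^k(Y)}\|A+b\|$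 (norms of $Y$). A complex $Y$ is an $\alpha$-skeleton expander if for every $A\subset Y(0)$, $\|E(A,A)\|\le 4(\|A\|^2+\alpha\|A\|)$, where $E(A,A)\subset Y(1)$ is the set of edges with both endpoints in $A$ and all norms are those of $Y$. *)

(* Defs.v *)
From HB Require Import structures.
From mathcomp Require Import all_boot all_order all_algebra.
Set Implicit Arguments. Unset Strict Implicit. Unset Printing Implicit Defensive.
Import Order.TTheory GRing.Theory Num.Theory.
Local Open Scope ring_scope.

(* A simplicial complex on a finite vertex type V is a set of faces X : {set {set V}}.
   Faces are indexed by their SIZE s = |sigma| (= dim + 1); X(k) = faces X k.+1. *)
Definition faces (V : finType) (X : {set {set V}}) (s : nat) : {set {set V}} :=
  [set sg in X | #|sg| == s].

Definition is_dcomplex (V : finType) (d : nat) (X : {set {set V}}) : Prop :=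
  [/\ set0 \in X,
      (forall t : {set V}, t \in X -> forall s : {set V}, s \subset t -> s \in X),
      (forall s : {set V}, s \in X -> (#|s| <= d.+1)%N) &
      (forall s : {set V}, s \in X -> exists2 F, F \in faces X d.+1 & s \subset F)].

Definition link (V : finType) (X : {set {set V}}) (sg : {set V}) : {set {set V}} :=
  [set t in X | [disjoint t & sg] && (t :|: sg \in X)].

Definition weight (R : realFieldType) (V : finType) (n : nat) (Y : {set {set V}})
  (sg : {set V}) : R :=
  (#|[set F in faces Y n.+1 | sg \subset F]|)%:R /
  (('C(n.+1, #|sg|) * #|faces Y n.+1|)%N)%:R.

Definition norm (R : realFieldType) (V : finType) (n : nat) (Y : {set {set V}})
  (A : {set {set V}}) : R :=
  \sum_(sg in A) weight R n Y sg.

(* symmetric difference = addition of F_2-cochains *)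
Definition symd (T : finType) (A B : {set T}) : {set T} := (A :\: B) :|: (B :\: A).

(* coboundary of a cochain A supported on faces of size s (i.e. dimension s-1) *)
Definition deltaS (V : finType) (Y : {set {set V}}) (s : nat) (A : {set {set V}})
  : {set {set V}} :=
  [set t in faces Y s.+1 | odd #|[set sg in A | (#|sg| == s) && (sg \subset t)]|].

Definition cocycleb (V : finType) (Y : {set {set V}}) (k : nat) (A : {set {set V}}) : bool :=
  (A \subset faces Y k.+1) && (deltaS Y k.+1 A == set0).

Definition cobndb (V : finType) (Y : {set {set V}}) (k : nat) (A : {set {set V}}) : bool :=
  [exists A' : {set {set V}}, (A' \subset faces Y k) && (deltaS Y k A' == A)].

(* min over z in Z^k of ||A + z|| (Z^k contains 0, so ||A|| is a harmless seed) *)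
Definition distZ (R : realFieldType) (V : finType) (n : nat) (Y : {set {set V}})
  (k : nat) (A : {set {set V}}) : R :=
  \big[Num.min/norm R n Y A]_(z | cocycleb Y k z) norm R n Y (symd A z).

Definition distB (R : realFieldType) (V : finType) (n : nat) (Y : {set {set V}})
  (k : nat) (A : {set {set V}}) : R :=
  \big[Num.min/norm R n Y A]_(b | cobndb Y k b) norm R n Y (symd A b).

Definition cob_expander (R : realFieldType) (V : finType) (m : nat) (Y : {set {set V}})
  (beta : R) : Prop :=
  forall k, (k < m)%N -> forall A : {set {set V}}, A \subset faces Y k.+1 -> ~~ cobndb Y k A ->
    beta * distB R m Y k A <= norm R m Y (deltaS Y k.+1 A).

(* E(A,A): edges with both endpoints in A (A a set of vertex-faces) *)
Definition edgesIn (V : finType) (Y : {set {set V}}) (A : {set {set V}}) : {set {set V}} :=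
  [set e in faces Y 2 | e \subset \bigcup_(a in A) a].

Definition skel_expander (R : realFieldType) (V : finType) (m : nat) (Y : {set {set V}})
  (alpha : R) : Prop :=
  forall A : {set {set V}}, A \subset faces Y 1 ->
    norm R m Y (edgesIn Y A) <= 4 * (norm R m Y A ^+ 2 + alpha * norm R m Y A).

(* Exp_z^k(X) >= eps, with Exp_z^k the min over A in C^k \ Z^k (min of empty = oo) *)
Definition Exp_ge (R : realFieldType) (V : finType) (d : nat) (X : {set {set V}})
  (k : nat) (eps : R) : Prop :=
  forall A : {set {set V}}, A \subset faces X k.+1 -> ~~ cocycleb X k A ->
    eps <= norm R d X (deltaS X k.+1 A) / distZ R d X k A.

(* Syst^r(X) >= mu, with Syst^r the min over z in Z^r \ B^r (min of empty = oo) *)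
Definition Syst_ge (R : realFieldType) (V : finType) (d : nat) (X : {set {set V}})
  (r : nat) (mu : R) : Prop :=
  forall z : {set {set V}}, cocycleb X r z -> ~~ cobndb X r z -> mu <= norm R d X z.

(* Main.v *)
Require Import Defs.
From HB Require Import structures.
From mathcomp Require Import all_boot all_order all_algebra.
From mathcomp Require Import zify ring.
Import Order.TTheory GRing.Theory Num.Theory.
Set Implicit Arguments. Unset Strict Implicit. Unset Printing Implicit Defensive.

(** Both bounds reduce to one rigidity statement: a locally minimal cocycle [A]
    (one whose localization in the link of every nonempty face has minimal norm
    in its class modulo coboundaries) of small norm vanishes.  For the systole,
    apply it to a cocycle of minimal norm in its cohomology class.  For the
    expansion, make the coboundary of a cochain locally minimal by a greedy
    descent, whose total cost is controlled by the degree bound; the result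
    vanishes, so the cost bounds the distance to the cocycles.

    For the rigidity, let level-0 fat faces be the elements of [A], and call a
    face of one size less fat when a non-negligible part of its cofaces is fat
    one level below.  A coface [t] of [A] is degenerate when it contains two
    adjacent fat faces of the same level whose intersection is not fat; skeleton
    expansion in the links of nonfat faces makes degenerate faces rare.  Let
    [L s] be the set of faces of [A] reached from a fat [s] by a ladder of fat
    faces.  As a part of a minimal cochain, [L s] is minimal in the link of [s],
    so coboundary expansion bounds its mass by that of its coboundary.  But a
    nondegenerate face in this coboundary contains, [A] being a cocycle, a face
    of [A] that misses a vertex of [s], and then the ladder extends one level
    further.  Hence the mass reached from level [n] is bounded by the degenerate
    mass plus the mass reached from level [n + 1]; the empty face is not fat
    when [A] is small, so the mass of [A] is at most a small multiple of itself. *)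

Local Open Scope nat_scope.

(** * Cochains over F_2 as sets under symmetric difference *)

Section Cochains.
Variables (T : finType).
Implicit Types A B : {set T}.

Lemma in_symd A B x : (x \in symd A B) = (x \in A) (+) (x \in B).
Proof. by rewrite !inE; case: (x \in A); case: (x \in B). Qed.

Lemma symd_id A : symd A A = set0.
Proof. by apply/setP=> x; rewrite in_symd addbb inE. Qed.

Lemma symd0 A : symd A set0 = A.
Proof. by apply/setP=> x; rewrite in_symd inE addbF. Qed.

Lemma symdA A B C : symd A (symd B C) = symd (symd A B) C.
Proof. by apply/setP=> x; rewrite !in_symd addbA. Qed.

Lemma symd_eq0 A B : symd A B = set0 -> A = B.
Proof.
move=> e; apply/setP => x; move/setP/(_ x): e; rewrite in_symd in_set0.
by case: (x \in A); case: (x \in B).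
Qed.

Lemma sum_symd (F : T -> nat) A B :
  \sum_(x in symd A B) F x + 2 * \sum_(x in A :&: B) F x =
  \sum_(x in A) F x + \sum_(x in B) F x.
Proof.
rewrite !(big_mkcond (fun x => x \in _)) /= big_distrr -!big_split /=.
apply: eq_bigr => x _; rewrite in_symd inE.
by case: (x \in A); case: (x \in B) => /=; lia.
Qed.

Lemma odd_sum_card (P : pred T) (F : T -> nat) :
  odd (\sum_(x | P x) F x) = odd #|[set x | P x & odd (F x)]|.
Proof.
rewrite -sum1_card.
under [in RHS]eq_bigl => x do rewrite inE.
rewrite big_mkcondr /= !(big_morph odd oddD (erefl _)).
by apply: eq_bigr => x _; case: (odd (F x)).
Qed.

Lemma odd_card_symd A B (P : pred T) :
  odd #|[set x in symd A B | P x]| =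
  odd #|[set x in A | P x]| (+) odd #|[set x in B | P x]|.
Proof.
have := sum_symd (fun => 1) [set x in A | P x] [set x in B | P x].
rewrite !sum1_card mul2n => /(congr1 odd); rewrite !oddD odd_double addbF => <-.
congr (odd #|pred_of_set _|); apply/setP=> x; rewrite !(inE, in_symd).
by case: (x \in A); case: (x \in B); case: (P x).
Qed.

End Cochains.

(** * Masses of cochains and the coboundary operator *)

Section Complex.
Variables (V : finType) (d : nat) (X : {set {set V}}).
Hypothesis hX : is_dcomplex d X.
Implicit Types (a b s t F : {set V}) (A B : {set {set V}}).

Definition topdeg a := #|[set F in faces X d.+1 | a \subset F]|.

(* On faces of a fixed size, [mass] is proportional to [norm], both in [X] and in
   every link, which lets all double counting take place in [nat]. *)
Definition mass A := \sum_(a in A) topdeg a.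

Lemma face_sub s t : t \in X -> s \subset t -> s \in X.
Proof. by case: hX => _ + _ _ => h /h; apply. Qed.

Lemma face_card s : s \in X -> #|s| <= d.+1.
Proof. by case: hX => _ _ h _; apply: h. Qed.

Lemma in_faces A n s : (s \in faces A n) = (s \in A) && (#|s| == n).
Proof. by rewrite inE. Qed.

Lemma topdeg_gt0 a : a \in X -> 0 < topdeg a.
Proof.
case: hX => _ _ _ h /h [F F1 F2].
by rewrite card_gt0; apply/set0Pn; exists F; rewrite inE F1.
Qed.

(** Double counting of the pairs formed by a face of [A] and a top face above it. *)
Lemma massE A :
  mass A = \sum_(F in faces X d.+1) #|[set a in A | a \subset F]|.
Proof.
rewrite /mass; under eq_bigr => a _.
  rewrite /topdeg -sum1_card.
  under eq_bigl => F do rewrite inE.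
  over.
rewrite (exchange_big_dep (fun F => F \in faces X d.+1)) /=; last by move=> a F _ /andP[].
apply: eq_bigr => F HF; rewrite -sum1_card; apply: eq_bigl => a.
by rewrite inE HF.
Qed.

Lemma card_subfaces A t : t \in X -> #|[set a in A | a \subset t]| <= 2 ^ d.+1.
Proof.
move=> tX; apply: (@leq_trans #|powerset t|).
  by apply/subset_leq_card/subsetP => a; rewrite !inE => /andP[].
by rewrite card_powerset leq_pexp2l // face_card.
Qed.

Lemma mass_above_le B a :
  (forall b, b \in B -> a \subset b) -> mass B <= 2 ^ d.+1 * topdeg a.
Proof.
move=> aB; rewrite massE (bigID (fun F => a \subset F)) /= [X in _ + X]big1 ?addn0.
  rewrite mulnC /topdeg -sum_nat_const.
  rewrite (eq_bigl (fun F => F \in [set F in faces X d.+1 | a \subset F])); last first.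
    by move=> F; rewrite [in RHS]inE.
  by apply: leq_sum => F; rewrite !inE => /andP[/andP[FX _] _]; exact: card_subfaces.
move=> F /andP[_ naF]; apply/eqP; rewrite cards_eq0; apply/eqP/setP=> b.
rewrite !inE; apply/andP => -[/aB ab bF]; case/negP: naF; exact: subset_trans bF.
Qed.

(** As [n <= d], a top face above [a] has a vertex outside [a]; adding it to [a] gives a coface
    counted on the right. *)
Lemma topdeg_le_cofaces a n : #|a| = n -> n <= d ->
  topdeg a <= mass [set t in faces X n.+1 | a \subset t].
Proof.
move=> an nd; rewrite massE /topdeg -sum1_card.
under eq_bigl => F do rewrite inE.
rewrite big_mkcondr /=; apply: leq_sum => F; rewrite in_faces => /andP[FX /eqP Fd].
case: ifP => // aF; rewrite card_gt0.
have: 0 < #|F :\: a| by rewrite cardsDS // Fd an subn_gt0.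
case/card_gt0P=> x; rewrite inE => /andP[xa xF]; apply/set0Pn; exists (x |: a).
have xaF : x |: a \subset F by rewrite subUset sub1set xF.
by rewrite inE xaF andbT inE in_faces (face_sub FX xaF) subsetUr cardsU1 xa an eqxx.
Qed.

Lemma mass_sub A B : A \subset B -> mass A <= mass B.
Proof.
move=> /subsetP AB; rewrite /mass [X in _ <= X](bigID (fun a => a \in A)) /=.
rewrite (eq_bigl (fun a => (a \in B) && (a \in A))) ?leq_addr // => a.
by case: (boolP (a \in A)) => [/AB ->|]; rewrite ?andbF.
Qed.

Lemma mass_cover (I : finType) (P : pred I) (E : I -> {set {set V}}) B :
  (forall b, b \in B -> exists2 i, P i & b \in E i) ->
  mass B <= \sum_(i | P i) mass (E i).
Proof.
move=> BE; rewrite /mass.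
rewrite (exchange_big_dep predT) //= big_mkcond.
apply: leq_sum => b _; case: ifP => // /BE [i Pi bi].
by rewrite (bigD1 i) ?Pi //= leq_addr.
Qed.

Lemma mass_setU A B : mass (A :|: B) <= mass A + mass B.
Proof.
have -> : mass A + mass B = \sum_(i : bool) mass (if i then A else B).
  by rewrite big_bool.
apply: mass_cover => b; rewrite inE => /orP[]; [exists true|exists false] => //.
Qed.

(** Each [b] is counted once per member of [S] below it, and it has at most [2 ^ d.+1] subsets. This
    overlap is the price of summing local estimates over many faces [s]. *)
Lemma sum_mass_above (S B : {set {set V}}) : B \subset X ->
  \sum_(s in S) mass [set b in B | s \subset b] <= 2 ^ d.+1 * mass B.
Proof.
move=> /subsetP BX; rewrite /mass.
under eq_bigr => s _ do (under eq_bigl => b do rewrite inE).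
rewrite (exchange_big_dep (fun b => b \in B)) /=; last by move=> s b _ /andP[].
rewrite big_distrr /=; apply: leq_sum => b bB.
rewrite sum_nat_const leq_mul2r -orbC; apply/orP; left.
apply: leq_trans (card_subfaces S (BX _ bB)); apply/subset_leq_card/subsetP => s.
by rewrite !inE bB.
Qed.

Lemma mass_cofaces_le A B : A \subset X ->
  (forall b, b \in B -> exists2 a, a \in A & a \subset b) ->
  mass B <= 2 ^ d.+1 * mass A.
Proof.
move=> AX BA; apply: (@leq_trans (\sum_(a in A) mass [set b in B | a \subset b])).
  apply: mass_cover => b bB; have [a aA ab] := BA b bB.
  by exists a => //; rewrite inE bB.
rewrite {2}/mass big_distrr /=; apply: leq_sum => a _; apply: mass_above_le => b.
by rewrite inE => /andP[].
Qed.

Lemma mass_le A : mass A <= 2 ^ d.+1 * #|faces X d.+1|.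
Proof.
apply: (leq_trans (mass_above_le (a := set0) _)) => [b _|]; first exact: sub0set.
rewrite leq_mul2l -orbC; apply/orP; left.
by apply/subset_leq_card/subsetP => F; rewrite inE => /andP[].
Qed.

Lemma mass_eq0 A : A \subset X -> mass A = 0 -> A = set0.
Proof.
move=> /subsetP AX /eqP; rewrite sum_nat_eq0 => /forallP h; apply/setP=> a.
rewrite inE; apply/negbTE/negP => aA; have := topdeg_gt0 (AX _ aA).
by move: (h a); rewrite aA /= => /eqP ->.
Qed.

Lemma mass_symd A B : mass (symd A B) + 2 * mass (A :&: B) = mass A + mass B.
Proof. exact: sum_symd. Qed.

(* [mass A <= mass (symd A B)] says [2 * mass (A :&: B) <= mass B], which is
   inherited by subsets of [A]: minimality passes to subcochains. *)
Lemma mass_symd_le A B (L : {set {set V}}) :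
  L \subset A -> mass A <= mass (symd A B) -> mass L <= mass (symd L B).
Proof.
move=> LA; have := mass_symd A B; have := mass_symd L B.
by have /mass_sub := setSI B LA; lia.
Qed.

Lemma in_delta n A t : (t \in deltaS X n A) =
  (t \in faces X n.+1) && odd #|[set s in A | (#|s| == n) && (s \subset t)]|.
Proof. by rewrite inE. Qed.

Lemma delta_sub n A : deltaS X n A \subset faces X n.+1.
Proof. by apply/subsetP=> t; rewrite in_delta => /andP[]. Qed.

Lemma faces_subX n : faces X n \subset X.
Proof. by apply/subsetP=> t; rewrite in_faces => /andP[]. Qed.

Lemma delta_symd n A B :
  deltaS X n (symd A B) = symd (deltaS X n A) (deltaS X n B).
Proof.
apply/setP=> t; rewrite in_symd !in_delta odd_card_symd.
by case: (_ \in faces _ _).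
Qed.

Lemma symd_faces n A B : A \subset faces X n -> B \subset faces X n ->
  symd A B \subset faces X n.
Proof.
move=> /subsetP hA /subsetP hB; apply/subsetP=> x; rewrite in_symd.
by case: (boolP (x \in A)) => [/hA //|_ /=]; exact: hB.
Qed.

(** The intermediate sets are [x |: s] for the two elements [x] of [t :\: s]. *)
Lemma card_between s t n : s \subset t -> #|s| = n -> #|t| = n.+2 ->
  #|[set b : {set V} | [&& #|b| == n.+1, s \subset b & b \subset t]]| = 2.
Proof.
move=> st sn tn.
have -> : 2 = #|t :\: s| by rewrite cardsDS // sn tn; lia.
rewrite -(card_in_imset (f := fun x => x |: s) (D := t :\: s)); last first.
  move=> x y; rewrite !inE => /andP[xs _] _ /setP/(_ x).
  by rewrite !inE eqxx (negPf xs) !orbF => /esym/eqP.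
congr #|pred_of_set _|; apply/setP=> b; apply/idP/imsetP => [|[x]].
  rewrite inE => /and3P[/eqP bn sb bt].
  have /cards1P[x xE] : #|b :\: s| == 1 by rewrite cardsDS // bn sn subSnn.
  have /setDP[xb xs] : x \in b :\: s by rewrite xE set11.
  exists x; first by rewrite inE xs (subsetP bt).
  by rewrite -xE setUC -[LHS](setID b s) (setIidPr sb).
rewrite !inE => /andP[xs xt ->].
by rewrite cardsU1 xs sn eqxx subsetUr subUset sub1set xt.
Qed.

(** Each [a] below [t] lies in exactly two intermediate faces, so its contributions cancel modulo
    2. *)
Lemma delta_delta n A : deltaS X n.+1 (deltaS X n A) = set0.
Proof.
apply/setP=> t; rewrite in_delta in_set0; apply/negbTE/negP => /andP[].
rewrite in_faces => /andP[tX /eqP tn].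
pose N b := #|[set a in A | (#|a| == n) && (a \subset b)]|.
have -> : [set s in deltaS X n A | (#|s| == n.+1) && (s \subset t)] =
  [set b : {set V} | (#|b| == n.+1) && (b \subset t) & odd (N b)].
  apply/setP=> b; rewrite [LHS]inE [RHS]inE in_delta in_faces -/(N b).
  case bt: (b \subset t); rewrite ?andbF //= (face_sub tX bt) !andbT /=.
  by case: (#|b| == n.+1); rewrite ?andbF ?andbT.
rewrite -odd_sum_card /N.
under eq_bigr => b _.
  rewrite -sum1_card; under eq_bigl => a do rewrite inE.
  over.
rewrite (exchange_big_dep (fun a => [&& a \in A, #|a| == n & a \subset t])) /=; last first.
  move=> b a /andP[_ bt] /and3P[-> -> ab] /=; exact: subset_trans bt.
rewrite (eq_bigr (fun => 2)); first by rewrite sum_nat_const oddM andbF.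
move=> a /and3P[aA /eqP an aT]; rewrite -[RHS](card_between aT an tn) -[RHS]sum1_card.
by apply: eq_bigl => b; rewrite !inE aA an eqxx /= -andbA; do !case: (_ \subset _).
Qed.

End Complex.

Lemma bin_le_exp2 n k : 'C(n, k) <= 2 ^ n.
Proof.
have [kn|] := leqP k n; last by move=> /bin_small ->.
have := expnDn 1 1 n; rewrite (bigD1 (Ordinal (kn : k < n.+1))) //= !exp1n !muln1 => ->.
exact: leq_addr.
Qed.

(** * Links: translation of cochains, and expansion stated in terms of mass *)

Section Link.
Variables (R : realFieldType) (V : finType) (d : nat) (X : {set {set V}}).
Hypothesis hX : is_dcomplex d X.
Variable s : {set V}.
Implicit Types (a b t F : {set V}) (A B L : {set {set V}}).

(** Cochains of the link of [s] are handled as cochains of [X] all of whose faces contain [s];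
    [strip] translates them into the link. *)
Definition above A := [forall a in A, s \subset a].

Definition strip A : {set {set V}} := [set a :\: s | a in A].

Lemma aboveP A : reflect {in A, forall a, s \subset a} (above A).
Proof. exact: forall_inP. Qed.

Lemma setD_inj a b : s \subset a -> s \subset b -> a :\: s = b :\: s -> a = b.
Proof. by move=> sa sb e; rewrite -(setID a s) -(setID b s) (setIidPr sa) (setIidPr sb) e. Qed.

Lemma setDUK a : s \subset a -> (a :\: s) :|: s = a.
Proof. by move=> sa; rewrite setUC -[RHS](setID a s) (setIidPr sa). Qed.

Lemma setUDK t : [disjoint t & s] -> (t :|: s) :\: s = t.
Proof. by move=> ts; rewrite setDUl setDv setU0; apply/setDidPl. Qed.

Lemma disjoint_setD a : [disjoint a :\: s & s].
Proof. by rewrite -setI_eq0 setIDAC -setIDA setDv setI0. Qed.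

Lemma in_strip A t : above A -> (t \in strip A) = [disjoint t & s] && (t :|: s \in A).
Proof.
move=> /aboveP sA; apply/imsetP/andP => [[a aA ->]|[ts tA]].
  by rewrite disjoint_setD setDUK // sA.
by exists (t :|: s) => //; rewrite setUDK.
Qed.

Lemma strip_injective A : above A -> {in A &, injective (fun a => a :\: s)}.
Proof. by move=> /aboveP sA a b /sA ? /sA ?; apply: setD_inj. Qed.

Lemma in_link t : (t \in link X s) = [disjoint t & s] && (t :|: s \in X).
Proof.
rewrite inE; case: (boolP (t :|: s \in X)) => h; rewrite ?andbF // !andbT.
by rewrite (face_sub hX h) // subsetUl.
Qed.

Lemma in_faces_link n t :
  (t \in faces (link X s) n) = [disjoint t & s] && (t :|: s \in faces X (n + #|s|)).
Proof.
rewrite !in_faces in_link -andbA; case: (boolP [disjoint t & s]) => //= ts.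
by rewrite cardsU (disjoint_setI0 ts) cards0 subn0 eqn_add2r.
Qed.

Lemma card_setUs t : [disjoint t & s] -> #|t :|: s| = #|t| + #|s|.
Proof. by move=> ts; rewrite cardsU (disjoint_setI0 ts) cards0 subn0. Qed.

Lemma faces_strip n A : above A -> (A \subset faces X (n + #|s|)) =
  (strip A \subset faces (link X s) n).
Proof.
move=> sA; apply/subsetP/subsetP => h t.
  by rewrite in_strip // in_faces_link => /andP[-> /h].
move=> tA; have st := aboveP _ sA t tA; move: (h (t :\: s)).
by rewrite in_strip // in_faces_link disjoint_setD setDUK //=; apply.
Qed.

Lemma strip_setU A : {in A, forall t, [disjoint t & s]} ->
  strip [set t :|: s | t in A] = A.
Proof.
move=> h; rewrite /strip -imset_comp -[RHS]imset_id; apply: eq_in_imset => t /h /=.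
exact: setUDK.
Qed.

Lemma above_setU A : above [set t :|: s | t in A].
Proof. by apply/aboveP => _ /imsetP[t _ ->]; rewrite subsetUr. Qed.

Lemma above_symd A B : above A -> above B -> above (symd A B).
Proof.
move=> /aboveP hA /aboveP hB; apply/aboveP => a; rewrite in_symd.
by case: (boolP (a \in A)) => [/hA //|_ /hB].
Qed.

Lemma strip_symd A B : above A -> above B ->
  strip (symd A B) = symd (strip A) (strip B).
Proof.
move=> hA hB; apply/setP => t; rewrite in_symd !in_strip ?above_symd // in_symd.
by case: [disjoint _ & _].
Qed.

Lemma above_delta n A : above A -> above (deltaS X n A).
Proof.
move=> /aboveP hA; apply/aboveP => t; rewrite in_delta => /andP[_].
case: (posnP #|[set a in A | (#|a| == n) && (a \subset t)]|) => [->//|].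
by case/card_gt0P => a; rewrite !inE => /and3P[/hA sa _ at_] _; apply: subset_trans at_.
Qed.

(** Facets of [t :|: s] containing [s] correspond to facets of [t]; the other facets are absent from
    [A], so the parities agree. *)
Lemma strip_delta n A : above A ->
  deltaS (link X s) n (strip A) = strip (deltaS X (n + #|s|) A).
Proof.
move=> hA; apply/setP => t; rewrite in_strip ?above_delta // !in_delta in_faces_link andbA.
case: (boolP [disjoint t & s]) => //= ts; congr (_ && odd _).
rewrite -[RHS](card_in_imset (f := fun a => a :\: s)); last first.
  by move=> a b; rewrite !inE => /andP[aA _] /andP[bA _]; exact: (strip_injective hA).
congr #|pred_of_set _|; apply/setP => g; apply/idP/imsetP.
  rewrite inE => /and3P[/imsetP[a aA ->] gn gt].
  have sa := aboveP _ hA a aA; exists a => //; rewrite inE aA.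
  have := card_setUs (disjoint_setD a); rewrite (setDUK sa) => ->.
  by rewrite eqn_add2r gn setUC -subDset.
case=> a aP ->; move: aP; rewrite [a \in _]in_set => /and3P[aA an at_].
have sa := aboveP _ hA a aA.
rewrite inE subDset setUC at_ andbT cardsDS // (imset_f _ aA) /=.
by move/eqP: an => ->; rewrite addnK.
Qed.

Hypothesis sd : #|s| <= d.

Lemma card_link_topdeg a : s \subset a ->
  #|[set F in faces (link X s) (d - #|s|).+1 | a :\: s \subset F]| = topdeg d X a.
Proof.
move=> sa; rewrite /topdeg.
have sub : above [set F in faces X d.+1 | a \subset F].
  by apply/aboveP => F; rewrite inE => /andP[_]; apply: subset_trans.
rewrite -[RHS](card_in_imset (strip_injective sub)).
congr #|pred_of_set _|; apply/setP=> F; rewrite in_strip //.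
rewrite [LHS]inE in_faces_link [in RHS]in_set.
have -> : (d - #|s|).+1 + #|s| = d.+1 by lia.
by rewrite -andbA subDset setUC.
Qed.

Lemma weight_link a : s \subset a ->
  weight R (d - #|s|) (link X s) (a :\: s) =
  ((topdeg d X a)%:R / ('C((d - #|s|).+1, #|a| - #|s|) * topdeg d X s)%:R)%R.
Proof.
move=> sa; rewrite /weight card_link_topdeg // cardsDS //; congr (_ / (_ * _)%:R)%R.
rewrite -(card_link_topdeg (subxx s)) setDv; congr #|pred_of_set _|.
by apply/setP=> F; rewrite [RHS]inE sub0set andbT.
Qed.

Lemma norm_link n A : above A -> A \subset faces X n ->
  norm R (d - #|s|) (link X s) (strip A) =
  ((mass d X A)%:R / ('C((d - #|s|).+1, n - #|s|) * topdeg d X s)%:R)%R.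
Proof.
move=> hA /subsetP An; rewrite /norm big_imset /=; last exact: strip_injective.
rewrite /mass natr_sum big_distrl /=; apply: eq_bigr => a aA.
rewrite weight_link; last exact: (aboveP _ hA).
by move: (An a aA); rewrite in_faces => /andP[_ /eqP ->].
Qed.

Hypothesis sX : s \in X.
Local Open Scope ring_scope.

(** Minimality makes the norm of [strip A] its distance to the coboundaries of the link, so
    expansion applies to it; passing from norm to mass costs a ratio of binomials. *)
Lemma minimal_link_expansion (beta : R) k A : (k + #|s| < d)%N ->
  cob_expander (d - #|s|) (link X s) beta ->
  above A -> A \subset faces X (k.+1 + #|s|) ->
  (forall g, above g -> g \subset faces X (k + #|s|) ->
     mass d X A <= mass d X (symd A (deltaS X (k + #|s|) g)))%N ->
  beta * (mass d X A)%:R <= (2 ^ d.+1)%:R * (mass d X (deltaS X (k.+1 + #|s|) A))%:R.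
Proof.
move=> kd hexp hA Ak Amin.
(* Expansion says nothing about coboundaries, but there minimality tested on a primitive of [A]
   gives mass 0. *)
have [/existsP[g' /andP[g'k /eqP g'A]]|ncob] := boolP (cobndb (link X s) k (strip A)).
  pose g := [set t :|: s | t in g'].
  have g'E : strip g = g'.
    apply: strip_setU => t /(subsetP g'k); by rewrite in_faces_link => /andP[].
  have gs : above g := above_setU g'.
  have gk : g \subset faces X (k + #|s|) by rewrite faces_strip // g'E.
  have AE : deltaS X (k + #|s|) g = A.
    have e : strip (deltaS X (k + #|s|) g) = strip A by rewrite -strip_delta // g'E.
    apply/setP => a; have [sa|nsa] := boolP (s \subset a).
      move/setP/(_ (a :\: s)): e.
      by rewrite !in_strip ?above_delta // disjoint_setD setDUK.
    have /aboveP h := above_delta (k + #|s|) gs; move/aboveP: hA => h'.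
    by apply/idP/idP => [/h|/h'] sa; rewrite sa in nsa.
  have := Amin g gs gk; rewrite AE symd_id /mass big_set0 leqn0 => /eqP ->.
  by rewrite mulr0 mulr_ge0.
have km : (k < d - #|s|)%N by lia.
have Ak' : strip A \subset faces (link X s) k.+1 by rewrite -faces_strip.
have := hexp k km _ Ak' ncob.
have s0 : (0 < topdeg d X s)%N := topdeg_gt0 hX sX.
have C1 : (0 < 'C((d - #|s|).+1, k.+1))%N by rewrite bin_gt0; lia.
have C2 : (0 < 'C((d - #|s|).+1, k.+2))%N by rewrite bin_gt0; lia.
rewrite strip_delta // (norm_link (above_delta _ hA) (delta_sub _ _ _)).
have -> : ((k.+1 + #|s|).+1 - #|s| = k.+2)%N by lia.
have nA : norm R (d - #|s|) (link X s) (strip A) <= distB R (d - #|s|) (link X s) k (strip A).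
  apply/bigmin_geP; split => // b /existsP[g' /andP[g'k /eqP <-]].
  pose g := [set t :|: s | t in g'].
  have g'E : strip g = g'.
    apply: strip_setU => t /(subsetP g'k); by rewrite in_faces_link => /andP[].
  have gs : above g := above_setU g'.
  have gk : g \subset faces X (k + #|s|) by rewrite faces_strip // g'E.
  rewrite -g'E strip_delta // -strip_symd ?above_delta //.
  have sk := symd_faces Ak (delta_sub X (k + #|s|) g).
  rewrite (norm_link hA Ak) (norm_link (above_symd hA (above_delta _ gs)) sk).
  by rewrite ler_wpM2r ?invr_ge0 // ler_nat Amin.
rewrite (norm_link hA Ak) addnK in nA.
move: (mass d X _) nA => mA nA.
move: (mass d X _) => mD.
have [beta0|beta0 _] := leP 0 beta; last first.
  by apply: (@le_trans _ _ 0); rewrite ?mulr_ge0 // mulr_le0_ge0 // ltW.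
move=> /(le_trans (ler_wpM2l beta0 nA)).
have Ccast (C N : nat) : (0 < C)%N -> (0 < N)%N -> 0 < (C * N)%:R :> R.
  by rewrite ltr0n muln_gt0 => -> ->.
rewrite mulrA ler_pdivrMr ?Ccast // mulrAC => h.
(* Over a common denominator the claim compares two binomials, one at most [2 ^ d.+1] and the other
   at least 1. *)
have e : (2 ^ d.+1)%:R * mD%:R =
    (2 ^ d.+1)%:R * ('C((d - #|s|).+1, k.+2))%:R * (topdeg d X s)%:R * mD%:R /
    ('C((d - #|s|).+1, k.+2) * topdeg d X s)%:R :> R.
  by rewrite natrM; field; rewrite !pnatr_eq0 -!lt0n s0 C2.
apply: (le_trans h); rewrite e ler_pdivlMr ?Ccast // divfK; last by rewrite gt_eqF ?Ccast.
rewrite mulrC -!natrM ler_nat leq_mul2r; apply/orP; right.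
rewrite leq_mul2r; apply/orP; right.
apply: (@leq_trans (2 ^ d.+1)); last by rewrite leq_pmulr.
by apply: leq_trans (bin_le_exp2 _ _) _; rewrite leq_pexp2l // ltnS leq_subr.
Qed.

(** Once [s] is removed, members of [D] are edges with both ends in [strip U]. The density bound
    [theta] makes the quadratic term of skeleton expansion linear. *)
Lemma sparse_link_edges (alpha theta : R) U D : (#|s| < d)%N ->
  0 <= alpha -> 0 <= theta ->
  skel_expander (d - #|s|) (link X s) alpha ->
  above U -> U \subset faces X #|s|.+1 ->
  above D -> D \subset faces X #|s|.+2 ->
  {in D, forall t, {in t :\: s, forall x, x |: s \in U}} ->
  (mass d X U)%:R <= theta * (topdeg d X s)%:R ->
  (mass d X D)%:R <= 4 * (2 ^ d.+1)%:R * (theta + alpha) * (mass d X U)%:R.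
Proof.
move=> sd' a0 th0 hsk hU Us hD Ds DU Uth.
have U1 : strip U \subset faces (link X s) 1 by rewrite -faces_strip.
have sub : strip D \subset edgesIn (link X s) (strip U).
  apply/subsetP => e /imsetP[t tD ->]; rewrite inE.
  have st := aboveP _ hD t tD.
  have -> : t :\: s \in faces (link X s) 2.
    by rewrite in_faces_link disjoint_setD setDUK //= (subsetP Ds).
  apply/subsetP => x xt; apply/bigcupP; exists [set x]; last exact: set11.
  rewrite in_strip // (DU t) // andbT -setI_eq0 -subset0; apply/subsetP => y.
  by rewrite !inE => /andP[/eqP -> xs]; move: xt; rewrite inE xs.
have w0 (Y : {set {set V}}) m a : 0 <= weight R m Y a by rewrite /weight divr_ge0.
have := hsk _ U1.
have nsub : norm R (d - #|s|) (link X s) (strip D) <=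
            norm R (d - #|s|) (link X s) (edgesIn (link X s) (strip U)).
  rewrite /norm [leRHS](big_setID (strip D)) /= (setIidPr sub) lerDl.
  by apply: sumr_ge0.
move=> /(le_trans nsub).
have s0 : (0 < topdeg d X s)%N := topdeg_gt0 hX sX.
rewrite (norm_link hU Us) (norm_link hD Ds).
have -> : (#|s|.+1 - #|s| = 1)%N by rewrite subSnn.
have -> : (#|s|.+2 - #|s| = 2)%N by rewrite -addn2 addKn.
have C2 : (0 < 'C((d - #|s|).+1, 2))%N by rewrite bin_gt0 ltnS subn_gt0.
have C2e : ('C((d - #|s|).+1, 2) <= 2 ^ d.+1)%N.
  by apply: leq_trans (bin_le_exp2 _ _) _; rewrite leq_pexp2l // ltnS leq_subr.
rewrite bin1; move: Uth.
move: (mass d X U) (mass d X D) (topdeg d X s) s0 C2 C2e => mU mD N N0.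
move: ('C(_, _)) => C C0 Ce Uth.
have N0' : 0 < N%:R :> R by rewrite ltr0n.
have C0' : 0 < C%:R :> R by rewrite ltr0n.
rewrite ler_pdivrMr ?ltr0n ?muln_gt0 ?C0 // => h; apply: (le_trans h).
set n := (d - #|s|).+1.
have n0 : 0 < n%:R :> R by rewrite ltr0n.
have n1 : 1 <= n%:R :> R by rewrite ler1n.
(* [u] is the norm of [strip U] in the link, with [n] coming from ['C(n, 1)]. *)
set u := (mU%:R / (n * N)%:R : R).
have uN : u * (n * N)%:R = mU%:R by rewrite /u divfK // gt_eqF // ltr0n muln_gt0 N0.
have u0 : 0 <= u by rewrite divr_ge0.
have uNU : u * N%:R <= mU%:R.
  have -> : mU%:R = n%:R * (u * N%:R) :> R by rewrite -uN natrM; ring.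
  by rewrite ler_peMl // mulr_ge0 // ltW.
have uth : u <= theta.
  by rewrite -(ler_pM2r N0'); apply: le_trans uNU Uth.
clearbody u.
have -> : 4 * (u ^+ 2 + alpha * u) * (C * N)%:R = 4 * (u + alpha) * (C%:R * (u * N%:R)).
  by rewrite natrM; ring.
have -> : 4 * (2 ^ d.+1)%:R * (theta + alpha) * mU%:R =
  4 * (theta + alpha) * ((2 ^ d.+1)%:R * mU%:R) by ring.
apply: ler_pM.
- by rewrite mulr_ge0 // addr_ge0.
- by rewrite !mulr_ge0.
- by rewrite ler_pM2l // lerD2r.
- by apply: ler_pM => //; rewrite ?mulr_ge0 ?ler_nat.
Qed.

End Link.

(** * Fat faces, ladders and degenerate faces *)

Section Fat.
Variables (R : realFieldType) (V : finType) (d : nat) (X : {set {set V}}).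
Hypothesis hX : is_dcomplex d X.
Variables (K : nat) (A : {set {set V}}) (theta : nat -> R).
Hypothesis hA : A \subset faces X K.
Implicit Types (a b s t : {set V}) (B : {set {set V}}).

(* Fat faces of level [n] have size [K - n]. *)
Fixpoint fat n : {set {set V}} :=
  if n is m.+1 then
    [set s in X | (#|s| + m.+1 == K) &&
      (theta m * (topdeg d X s)%:R <= (mass d X [set b in fat m | s \subset b])%:R)%R]
  else A.

(** An increasing chain from [s] up to a member [a] of [A], with one fat face at each level from [n]
    down to 0. *)
Fixpoint ladder n s a : bool :=
  if n is m.+1 then
    (s \in fat m.+1) && [exists s', [&& s' \in fat m, s \subset s' & ladder m s' a]]
  else (s == a) && (a \in A).

Definition reached n := [set a in A | [exists s, ladder n s a]].

(** For distinct faces of one level, the size condition says that each has a single vertex outside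
    the other. *)
Definition degenerate_pair n (p : {set V} * {set V}) :=
  [&& p.1 \in fat n, p.2 \in fat n, p.1 != p.2,
      #|p.1 :|: p.2| == #|p.1|.+1 & p.1 :&: p.2 \notin fat n.+1].

Definition degenerate_unions n : {set {set V}} :=
  X :&: [set p.1 :|: p.2 | p in degenerate_pair n].

Definition degenerate :=
  [set t in faces X K.+1 |
    [exists n : 'I_K, [exists u in degenerate_unions n, u \subset t]]].

Lemma fat_face n s : s \in fat n -> s \in X /\ #|s| + n = K.
Proof.
case: n => [/(subsetP hA)|n]; first by rewrite in_faces => /andP[-> /eqP ->]; rewrite addn0.
by rewrite inE => /and3P[-> /eqP ->].
Qed.

Lemma degenerate_unionP n t : t \in degenerate_unions n -> t \in X /\
  exists s1 s2, [/\ s1 \in fat n, s2 \in fat n, t = s1 :|: s2,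
    #|s1 :|: s2| = #|s1|.+1 & s1 :&: s2 \notin fat n.+1].
Proof.
case/setIP => tX /imsetP[[s1 s2] p12 tE]; split=> //; exists s1, s2.
have {p12} : degenerate_pair n (s1, s2) by [].
by case/and5P => ? ? _ /eqP ? ?.
Qed.

Lemma ladder_fat n s a : ladder n s a -> s \in fat n.
Proof. by case: n => [/andP[/eqP ->]|n /andP[]]. Qed.

Lemma ladder_sub n s a : ladder n s a -> s \subset a.
Proof.
elim: n s => [|n IH] s /= /andP[]; first by move=> /eqP ->.
move=> _ /existsP[s' /and3P[_ ss' /IH]]; exact: subset_trans.
Qed.

Lemma ladder_step n s s' a : s \in fat n.+1 -> s' \in fat n -> s \subset s' ->
  ladder n s' a -> ladder n.+1 s a.
Proof.
by move=> sF s'F ss' la; apply/andP; split=> //; apply/existsP; exists s'; rewrite s'F ss'.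
Qed.

Lemma ladder_stepP n s a : ladder n.+1 s a ->
  exists s', [/\ s \in fat n.+1, s' \in fat n, s \subset s' & ladder n s' a].
Proof. by case/andP => sF /existsP[s' /and3P[? ? ?]]; exists s'. Qed.

Lemma nondegenerate_meet t n s1 s2 : t \in faces X K.+1 -> t \notin degenerate ->
  n < K -> s1 \in fat n -> s2 \in fat n -> s1 \subset t -> s2 \subset t ->
  s1 != s2 -> #|s1 :|: s2| = #|s1|.+1 -> s1 :&: s2 \in fat n.+1.
Proof.
move=> tK; have tX := subsetP (faces_subX X _) t tK.
rewrite inE tK /= => /existsPn h nK f1 f2 s1t s2t s12 e.
apply/negbNE/negP => nf; move/existsPn: (h (Ordinal nK)) => /(_ (s1 :|: s2)).
rewrite subUset s1t s2t /= andbT => /negP; apply.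
rewrite inE (face_sub hX tX) ?subUset ?s1t //=; apply/imsetP; exists (s1, s2) => //.
by rewrite unfold_in /degenerate_pair /= f1 f2 s12 e eqxx nf.
Qed.

(** Delete [y] from every rung. If [s'] is the rung above [s], then [s] and [s' :\ y] are adjacent
    fat faces of the same level meeting in [s :\ y], which is fat by nondegeneracy; by induction
    [s' :\ y] leads to both [a] and [t :\ y]. *)
Lemma ladder_drop t y n s a : t \in faces X K.+1 -> t \notin degenerate ->
  y \in t -> t :\ y \in A -> ladder n s a -> a \subset t -> y \in s ->
  ladder n.+1 (s :\ y) a /\ ladder n.+1 (s :\ y) (t :\ y).
Proof.
move=> tK tn yt tyA; have /andP[_ /eqP tc] : (t \in X) && (#|t| == K.+1) by rewrite -in_faces.
elim: n s => [|n IH] s.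
  (* At level 0 the adjacent pair is [a] and [t :\ y], both in [A]. *)
  move=> /andP[/eqP -> aA] at_ ya.
  have /fat_face[_ ac] : a \in fat 0 by [].
  have aE : a :&: (t :\ y) = a :\ y.
    by rewrite setIDA (setIidPl at_).
  have aN : a != t :\ y by apply: contraTneq ya => ->; rewrite !inE eqxx.
  have aU : #|a :|: (t :\ y)| = #|a|.+1.
    have -> : a :|: (t :\ y) = t.
      apply/setP=> x; rewrite !inE; case: (eqVneq x y) => [->|_] /=.
        by rewrite ya yt.
      by apply/orP/idP => [[/(subsetP at_)|]|->] //; right.
    by rewrite tc -ac addn0.
  have K0 : 0 < K by move: ac; rewrite (cardsD1 y a) ya; clear; lia.
  have F1 : a :\ y \in fat 1.
    rewrite -aE; apply: (nondegenerate_meet tK tn K0) => //; exact: subD1set.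
  split; [apply: (ladder_step F1 (s' := a))|apply: (ladder_step F1 (s' := t :\ y))] => //.
  - exact: subD1set.
  - by rewrite /= eqxx.
  - exact: setSD.
  - by rewrite /= eqxx.
move=> /ladder_stepP[s' [sF s'F ss' la]] at_ ys.
have ys' : y \in s' by apply: (subsetP ss').
have [l1 l2] := IH s' la at_ ys'.
have s't : s' \subset t := subset_trans (ladder_sub la) at_.
have [_ sc] := fat_face sF.
have [_ s'c] := fat_face s'F.
have s'y := ladder_fat l1.
have eI : s :&: (s' :\ y) = s :\ y by rewrite setIDA (setIidPl ss').
have eN : s != s' :\ y by apply: contraTneq ys => ->; rewrite !inE eqxx.
have eU : #|s :|: (s' :\ y)| = #|s|.+1.
  have -> : s :|: (s' :\ y) = s'.
    apply/setP=> x; rewrite !inE; case: (eqVneq x y) => [->|_] /=.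
      by rewrite ys ys'.
    by apply/orP/idP => [[/(subsetP ss')|]|->] //; right.
  by apply/eqP; rewrite -(eqn_add2r n) s'c addSnnS sc.
have nK : n.+1 < K by move: sc; rewrite (cardsD1 y s) ys; clear; lia.
have F : s :\ y \in fat n.+2.
  rewrite -eI; apply: (nondegenerate_meet tK tn nK) => //.
    exact: subset_trans ss' s't.
  exact: subset_trans (subD1set _ _) s't.
by split; apply: (ladder_step F s'y) => //; apply: setSD.
Qed.

(** Climb to the first rung [s'] containing [y]: by size, [s' :\ y] is the rung just below it, and
    [ladder_drop] leads from there to [t :\ y]. If no rung contains [y], then [a] is [t :\ y]
    itself. *)
Lemma ladder_transfer t y n s a : t \in faces X K.+1 -> t \notin degenerate ->
  y \in t -> t :\ y \in A -> ladder n s a -> a \subset t -> y \notin s ->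
  ladder n s (t :\ y).
Proof.
move=> tK tn yt tyA; have /andP[_ /eqP tc] : (t \in X) && (#|t| == K.+1) by rewrite -in_faces.
elim: n s => [|n IH] s.
  move=> /andP[/eqP -> aA] at_ ya; rewrite /= tyA andbT eqEcard subsetD1 at_ ya /=.
  have /fat_face[_ ac] : a \in fat 0 by [].
  by move: tc ac; rewrite (cardsD1 y t) yt; clear; lia.
move=> /ladder_stepP[s' [sF s'F ss' la]] at_ ys.
have [ys'|ys'] := boolP (y \in s'); last first.
  exact: (ladder_step sF s'F ss' (IH _ la at_ ys')).
have [_] := ladder_drop tK tn yt tyA la at_ ys'.
have [_ sc] := fat_face sF.
have [_ s'c] := fat_face s'F.
suff -> : s' :\ y = s by [].
apply/esym/eqP; rewrite eqEcard subsetD1 ss' ys /=.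
by move: sc s'c; rewrite (cardsD1 y s') ys'; clear; lia.
Qed.

Hypothesis cocycleA : deltaS X K A = set0.

Lemma cocycle_even t : t \in faces X K.+1 ->
  ~~ odd #|[set a in A | (#|a| == K) && (a \subset t)]|.
Proof.
move=> tK; have := in_delta X K A t.
by rewrite cocycleA in_set0 tK => /esym /= ->.
Qed.

Lemma facet_eq t a : t \in faces X K.+1 -> a \in A -> a \subset t ->
  exists2 y, y \in t & a = t :\ y.
Proof.
rewrite in_faces => /andP[_ /eqP tc] /(subsetP hA); rewrite in_faces => /andP[_ /eqP ac] at_.
have /cards1P[y yE] : #|t :\: a| == 1 by rewrite cardsDS // tc ac subSnn.
have /setDP[yt ya] : y \in t :\: a by rewrite yE set11.
by exists y => //; rewrite -yE setDDr setDv set0U (setIidPr at_).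
Qed.

(* Parity gives a facet of [t] in [A] that is not reached from [s]; it cannot
   contain [s] by [ladder_transfer], so [ladder_drop] lengthens the ladder. *)
Lemma delta_ladder t n s : t \in deltaS X K [set a in A | ladder n s a] ->
  t \notin degenerate -> exists2 a, a \in reached n.+1 & a \subset t.
Proof.
rewrite in_delta => /andP[tK oddL] tn; have evenA := cocycle_even tK.
set L' := [set _ in _ | _] in oddL; set A' := [set _ in _ | _] in evenA.
have LA : L' \subset A' by apply/subsetP => a; rewrite !inE => /andP[/andP[-> _] ->].
have /card_gt0P[a] : 0 < #|L'| by case: #|L'| oddL.
rewrite !inE => /andP[/andP[aA la] /andP[_ at_]].
have /subsetPn[b bA bL] : ~~ (A' \subset L').
  by apply: contra evenA => AL; have /eqP <- : L' == A' by rewrite eqEsubset LA.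
move: bA bL; rewrite !inE => /and3P[bA bK bt]; rewrite bA bK bt !andbT /= => nlb.
have [y yt bE] := facet_eq tK bA bt; rewrite bE in bA nlb.
have ys : y \in s by apply: contraR nlb => /(ladder_transfer tK tn yt bA la at_).
exists a => //; rewrite inE aA; apply/existsP; exists (s :\ y).
by have [] := ladder_drop tK tn yt bA la at_ ys.
Qed.

(** By parity [t] has a second facet in [A]. Were [t] nondegenerate, the intersection of the two
    facets would be fat and start a ladder to [a]. *)
Lemma unreached_coface a t : a \in A -> a \notin reached 1 ->
  t \in faces X K.+1 -> a \subset t -> t \in degenerate.
Proof.
move=> aA na tK at_; apply/negbNE/negP => tn; case/negP: na.
have evenA := cocycle_even tK; set A' := [set _ in _ | _] in evenA.
have [y yt aE] := facet_eq tK aA at_.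
have aK : #|a| == K by move/(subsetP hA): aA; rewrite in_faces => /andP[].
have /subsetPn[b bA ba] : ~~ (A' \subset [set a]).
  apply: contra evenA => AL; suff -> : A' = [set a] by rewrite cards1.
  by apply/eqP; rewrite eqEsubset AL sub1set inE aA aK.
move: bA ba; rewrite !inE => /and3P[bA _ bt] ba.
have [z zt bE] := facet_eq tK bA bt.
have za : z \in a by rewrite aE !inE zt andbT; apply: contra ba => /eqP zy; rewrite aE bE zy.
have la : ladder 0 a a by rewrite /= eqxx.
rewrite bE in bA; have [l _] := ladder_drop tK tn zt bA la at_ za.
by rewrite aA; apply/existsP; exists (a :\ z).
Qed.

End Fat.

Local Open Scope ring_scope.

(** * The constants and their numerical relations *)

Section Constants.
Variables (R : realFieldType) (d : nat) (beta : R).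

Definition subface_bound : R := (2 ^ d.+1)%:R.

(* [gain j] bounds the mass reached from the [j]-th level from the top in terms of
   the degenerate mass. *)
Fixpoint gain (j : nat) : R :=
  if j is i.+1 then subface_bound ^+ 3 * (1 + beta^-1) * (1 + gain i) else 0.

(** Small enough for [eta_small], which makes the final estimate of the mass of [A] by itself
    contracting. *)
Definition eta : R := (1 + 8 * d%:R * subface_bound ^+ 3 * gain d)^-1.

(* [growth] bounds [mass (fat n) / mass A]; the thresholds are chosen so that
   [threshold n * growth n = eta] at every level. *)
Fixpoint growth (n : nat) : R := if n is m.+1 then subface_bound * growth m ^+ 2 / eta else 1.

Definition threshold (n : nat) : R := eta / growth n.

Hypothesis beta0 : 0 < beta.

Lemma subface_bound_ge1 : 1 <= subface_bound.
Proof. by rewrite /subface_bound ler1n expn_gt0. Qed.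

Lemma subface_bound_gt0 : 0 < subface_bound.
Proof. exact: lt_le_trans ltr01 subface_bound_ge1. Qed.

Lemma gain_ge0 j : 0 <= gain j.
Proof.
elim: j => //= j IH; have := subface_bound_gt0; have : 0 < beta^-1 by rewrite invr_gt0.
by move=> *; rewrite !mulr_ge0 ?exprn_ge0 ?addr_ge0 // ltW.
Qed.

Lemma gain_le i j : (i <= j)%N -> gain i <= gain j.
Proof.
have m0 : 0 <= subface_bound ^+ 3 * (1 + beta^-1).
  by rewrite mulr_ge0 ?exprn_ge0 ?addr_ge0 ?invr_ge0 // ltW // subface_bound_gt0.
elim: i j => [|i IH] [|j] //=; first by move=> _; exact: (gain_ge0 j.+1).
by move=> /IH h; rewrite ler_wpM2l // lerD2l.
Qed.

Lemma eta_gt0 : 0 < eta.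
Proof.
by rewrite invr_gt0 ltr_pwDl // !mulr_ge0 ?exprn_ge0 ?gain_ge0.
Qed.

Lemma eta_le1 : eta <= 1.
Proof.
by rewrite invf_le1 ?lerDl ?ltr_pwDl // !mulr_ge0 ?exprn_ge0 ?gain_ge0.
Qed.

Lemma eta_small : 8 * d%:R * subface_bound ^+ 3 * gain d * eta < 1.
Proof.
have h : 0 < 1 + 8 * d%:R * subface_bound ^+ 3 * gain d by rewrite -invr_gt0; exact: eta_gt0.
by rewrite /eta ltr_pdivrMr // mul1r ltrDr.
Qed.

Lemma growth_ge1 n : 1 <= growth n.
Proof.
elim: n => //= n IH; rewrite ler_pdivlMr ?eta_gt0 // mul1r.
apply: (le_trans eta_le1); rewrite -[1]mul1r ler_pM ?subface_bound_ge1 //.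
by rewrite exprn_ege1.
Qed.

Lemma growth_gt0 n : 0 < growth n.
Proof. exact: lt_le_trans ltr01 (growth_ge1 n). Qed.

Lemma growth_le m n : (m <= n)%N -> growth m <= growth n.
Proof.
move=> /subnK <-; elim: (n - m)%N => //= k IH; apply: (le_trans IH).
rewrite ler_pdivlMr ?eta_gt0 //; move: (growth (k + m)) (growth_ge1 (k + m)) => g g1.
have g0 : 0 <= g by apply: le_trans g1.
rewrite mulrC expr2 mulrA ler_wpM2r //; apply: (le_trans eta_le1).
by rewrite -[1]mul1r ler_pM ?subface_bound_ge1.
Qed.

Lemma threshold_gt0 n : 0 < threshold n.
Proof. by rewrite divr_gt0 ?eta_gt0 ?growth_gt0. Qed.

Lemma threshold_growth n : threshold n * growth n = eta.
Proof. by rewrite divfK // gt_eqF // growth_gt0. Qed.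

(** The recursion of [growth] is this identity solved for [growth n.+1]; it drives the induction in
    [mass_fat]. *)
Lemma growthS n : threshold n * growth n.+1 = subface_bound * growth n.
Proof.
rewrite /threshold /=; field.
by rewrite !gt_eqF ?growth_gt0 ?eta_gt0.
Qed.

End Constants.

(** * Vanishing of small locally minimal cocycles *)

Section Rigidity.
Variables (R : realFieldType) (V : finType) (d : nat) (X : {set {set V}}).
Variables (beta : R) (K : nat) (A : {set {set V}}).
Hypothesis hX : is_dcomplex d X.
Hypothesis beta0 : 0 < beta.
Hypothesis K0 : (0 < K)%N.
Hypothesis Kd : (K <= d)%N.
Hypothesis hA : A \subset faces X K.

Local Notation c := (subface_bound R d).
Local Notation theta := (threshold d beta).
Local Notation alpha := (threshold d beta d).
Local Notation P := (growth d beta).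
Local Notation mu A := (mass d X A)%:R.
Local Notation fat := (fat d X K A theta).
Local Notation ladder := (ladder d X K A theta).
Local Notation reached := (reached d X K A theta).
Local Notation degenerate := (degenerate d X K A theta).
Local Notation degenerate_unions := (degenerate_unions d X K A theta).

Lemma fat_subX n : fat n \subset X.
Proof. by apply/subsetP=> s /(fat_face hA) []. Qed.

(** Fatness bounds [theta n] times the top degree of [s] by the mass of the fat faces above [s];
    summing over [s] counts each of those at most [c] times. *)
Lemma mass_fat n : mu (fat n) <= P n * mu A :> R.
Proof.
elim: n => [|n IH]; first by rewrite /= mul1r.
rewrite -(ler_pM2l (threshold_gt0 d beta0 n)) mulrA growthS // -[leRHS]mulrA.
have c0 := subface_bound_gt0 R d.
apply: (@le_trans _ _ (c * mu (fat n))); last by rewrite ler_pM2l.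
apply: (@le_trans _ _ (\sum_(s in fat n.+1) mu [set b in fat n | s \subset b])).
  rewrite [mass d X (fat n.+1)]/mass natr_sum big_distrr /=; apply: ler_sum => s.
  by rewrite inE => /and3P[].
by rewrite -natr_sum -natrM ler_nat (sum_mass_above hX) // fat_subX.
Qed.

Hypothesis skel : forall s, s \in X -> (#|s|.+1 <= d)%N ->
  skel_expander (d - #|s|) (link X s) alpha.

(** Each union is filed under the intersection [s] of its pair. In the link of [s] it is an edge
    between fat vertices, and nonfatness of [s] is the density bound required by
    [sparse_link_edges]. *)
Lemma mass_degenerate_unions n : (n < K)%N ->
  mu (degenerate_unions n) <= 4 * c ^+ 2 * (theta n + alpha) * mu (fat n) :> R.
Proof.
move=> nK.
pose I s := [&& s \in X, (#|s| + n.+1 == K)%N & s \notin fat n.+1].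
pose E (s : {set V}) := [set t in degenerate_unions n |
  (s \subset t) && [forall x in t :\: s, x |: s \in fat n]].
have th0 m : 0 <= theta m by apply/ltW/threshold_gt0.
have c0 : 0 <= c by apply/ltW/subface_bound_gt0.
apply: (@le_trans _ _ (\sum_(s | I s) mu (E s))).
  rewrite -natr_sum ler_nat; apply: mass_cover => t tD.
  have [tX [s1 [s2 [f1 f2 tE sU sI]]]] := degenerate_unionP tD.
  have [s1X c1] := fat_face hA f1; have [s2X c2] := fat_face hA f2.
  have cI := cardsUI s1 s2.
  exists (s1 :&: s2).
    rewrite /I (face_sub hX s1X) ?subsetIl //= sI andbT; apply/eqP.
    by move: c1 c2 cI; rewrite sU; clear; lia.
  rewrite inE tD tE /= (subset_trans (subsetIl s1 s2) (subsetUl _ _)) /=.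
  have key (s s' : {set V}) x : x \in s -> x \notin s' ->
      #|s :&: s'|.+1 = #|s| -> x |: (s :&: s') = s.
    move=> xs xs' e; apply/eqP; rewrite eqEcard subUset sub1set xs subsetIl /=.
    by rewrite cardsU1 inE (negPf xs') andbF /= -e.
  apply/forall_inP => x; rewrite !inE => /andP[/nandP[x1|x2] /orP[h|h]].
  - by rewrite h in x1.
  - by rewrite setIC key // setIC; move: c1 c2 cI; rewrite sU; clear; lia.
  - by rewrite key //; move: c1 c2 cI; rewrite sU; clear; lia.
  - by rewrite h in x2.
apply: (@le_trans _ _ (\sum_(s | I s)
    4 * c * (theta n + alpha) * mu [set b in fat n | s \subset b])).
  apply: ler_sum => s /and3P[sX /eqP sK sF].
  have sd : (#|s| < d)%N by lia.
  apply: (sparse_link_edges (s := s) hX (ltnW sd) sX sd) => //.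
  - exact: skel.
  - by apply/aboveP => b; rewrite inE => /andP[].
  - apply/subsetP => b; rewrite inE => /andP[/(fat_face hA)[bX bK] _].
    rewrite in_faces bX; apply/eqP; lia.
  - by apply/aboveP => b; rewrite inE => /and3P[].
  - apply/subsetP => t; rewrite inE => /andP[/degenerate_unionP[tX [s1 [s2 [f1 _ tE sU _]]]] _].
    have [_ c1] := fat_face hA f1.
    rewrite in_faces tX tE sU; apply/eqP; lia.
  - move=> t; rewrite inE => /and3P[_ st /forall_inP h] x xt; rewrite inE subsetUr andbT.
    exact: h.
  - apply: ltW; move: sF; rewrite inE sX sK eqxx /= -ltNge; exact.
rewrite -big_distrr /= expr2 -[leRHS]mulrA.
have -> : 4 * (c * c) * ((theta n + alpha) * mu (fat n)) =
  4 * c * (theta n + alpha) * (c * mu (fat n)) by ring.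
rewrite ler_wpM2l ?mulr_ge0 ?addr_ge0 // -natr_sum -natrM ler_nat.
apply: leq_trans (sum_mass_above hX [set s | I s] (fat_subX n)).
by rewrite big_mkcond [X in (_ <= X)%N]big_mkcond; apply: leq_sum => s _; rewrite inE.
Qed.

(** There are [K <= d] levels. Passing from unions to their cofaces costs the third factor [c], and
    [theta n] and [alpha] contribute one [eta] each. *)
Lemma mass_degenerate : mu degenerate <= 8 * d%:R * c ^+ 3 * eta d beta * mu A :> R.
Proof.
have th0 m : 0 <= theta m by apply/ltW/threshold_gt0.
have c0 : 0 <= c by apply/ltW/subface_bound_gt0.
have e0 : 0 <= eta d beta by apply/ltW/eta_gt0.
pose E (n : 'I_K) := [set t in degenerate | [exists u in degenerate_unions n, u \subset t]].
apply: (@le_trans _ _ (\sum_(n < K) mu (E n))).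
  rewrite -natr_sum ler_nat; apply: mass_cover => t tD.
  by move: (tD); rewrite inE => /andP[_ /existsP[n h]]; exists n => //; rewrite inE tD.
apply: (@le_trans _ _ (\sum_(n < K) 8 * c ^+ 3 * eta d beta * mu A)); last first.
  rewrite sumr_const card_ord -[leLHS]mulr_natr.
  have -> : 8 * d%:R * c ^+ 3 * eta d beta * mu A =
    8 * c ^+ 3 * eta d beta * mu A * d%:R by ring.
  by rewrite ler_wpM2l ?ler_nat // !mulr_ge0 ?exprn_ge0.
apply: ler_sum => n _.
apply: (@le_trans _ _ (c * mu (degenerate_unions n))).
  rewrite -natrM ler_nat; apply: (mass_cofaces_le hX); first exact: subsetIl.
  by move=> t; rewrite inE => /andP[_ /exists_inP[u]]; exists u.
have nK := ltn_ord n.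
apply: (le_trans (ler_wpM2l c0 (mass_degenerate_unions nK))).
have h1 : theta n * mu (fat n) <= eta d beta * mu A.
  apply: (le_trans (ler_wpM2l (th0 n) (mass_fat n))).
  by rewrite mulrA threshold_growth.
(* As [alpha] is the threshold of level [d] and [growth] is monotone,
   [alpha * P n <= alpha * P d = eta]. *)
have h2 : alpha * mu (fat n) <= eta d beta * mu A.
  apply: (le_trans (ler_wpM2l (th0 d) (mass_fat n))).
  rewrite mulrA ler_wpM2r // -(threshold_growth d beta0 d) ler_wpM2l //.
  apply: growth_le => //; lia.
have -> : c * (4 * c ^+ 2 * (theta n + alpha) * mu (fat n)) =
  4 * c ^+ 3 * (theta n * mu (fat n) + alpha * mu (fat n)) by ring.
have -> : 8 * c ^+ 3 * eta d beta * mu A =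
  4 * c ^+ 3 * (eta d beta * mu A + eta d beta * mu A) by ring.
by rewrite ler_wpM2l ?mulr_ge0 ?exprn_ge0 // lerD.
Qed.

Hypothesis cob : forall s, s \in X -> (1 <= #|s|)%N -> (#|s|.+1 <= d)%N ->
  cob_expander (d - #|s|) (link X s) beta.
Hypothesis minA : forall s g, s \in X -> s != set0 -> above s g ->
  g \subset faces X K.-1 -> (mass d X A <= mass d X (symd A (deltaS X K.-1 g)))%N.
Hypothesis cocycleA : deltaS X K A = set0.

Lemma mass_reached n : (0 < n < K)%N ->
  beta * mu (reached n) <= c ^+ 2 * (mu degenerate + c * mu (reached n.+1)).
Proof.
case/andP=> n0 nK; have c0 : 0 <= c by apply/ltW/subface_bound_gt0.
pose L s := [set a in A | ladder n s a].
(* By [delta_ladder], [W] contains the coboundary of every [L s], and it does not depend on [s]. *)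
pose W := degenerate :|: [set t in faces X K.+1 | [exists a in reached n.+1, a \subset t]].
have WX : W \subset X.
  by apply/subsetP => t; rewrite !inE => /orP[/andP[/andP[]]|/andP[/andP[]]].
apply: (@le_trans _ _ (\sum_(s in fat n) beta * mu (L s))).
  rewrite -big_distrr /= ler_pM2l // -natr_sum ler_nat; apply: mass_cover => a.
  rewrite inE => /andP[aA /existsP[s sa]]; exists s; first exact: ladder_fat sa.
  by rewrite inE aA.
apply: (@le_trans _ _ (\sum_(s in fat n) c * mu [set t in W | s \subset t])).
  apply: ler_sum => s sF; have [sX sK] := fat_face hA sF.
  have Ls : above s (L s).
    by apply/aboveP => a; rewrite inE => /andP[_ /ladder_sub].
  have LA : L s \subset A by apply/subsetP => a; rewrite inE => /andP[].
  (* In the link of [s], faces of [L s] have [n] vertices, hence dimension [n.-1]. *)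
  have eK : K = (n.-1.+1 + #|s|)%N by lia.
  have eK' : K.-1 = (n.-1 + #|s|)%N by lia.
  have := @minimal_link_expansion R V d X hX s _ sX beta n.-1 (L s).
  rewrite -eK -eK' => h; apply: (le_trans (h _ _ _ _ _ _)) => //.
  - by move: sK Kd; clear; lia.
  - by move: K0 Kd; clear; lia.
  - by apply: cob => //; move: sK n0 nK Kd; clear; lia.
  - exact: subset_trans LA hA.
  - move=> g gs gK; apply: (mass_symd_le LA); apply: (minA sX _ gs gK).
    by rewrite -card_gt0 -(ltn_add2r n) sK.
  - rewrite ler_wpM2l // ler_nat mass_sub //; apply/subsetP => t tD; rewrite inE.
    rewrite (aboveP _ _ (above_delta _ _ Ls) t tD) andbT inE.
    case: (boolP (t \in degenerate)) => //= tn; rewrite inE.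
    rewrite (subsetP (delta_sub _ _ _) t tD) /=; apply/exists_inP.
    by have [a a1 a2] := delta_ladder hX hA cocycleA tD tn; exists a.
rewrite -big_distrr /= expr2 -mulrA ler_wpM2l // -natr_sum.
apply: (@le_trans _ _ (c * mu W)).
  by rewrite -natrM ler_nat; exact: (sum_mass_above hX).
rewrite ler_wpM2l // -natrM -natrD ler_nat.
apply: (leq_trans (mass_setU _ _ _ _)); rewrite leq_add2l.
apply: (mass_cofaces_le hX).
  apply: subset_trans (faces_subX X K); apply: subset_trans hA.
  by apply/subsetP => a; rewrite inE => /andP[].
by move=> t; rewrite inE => /andP[_ /exists_inP[a]]; exists a.
Qed.

(** All cofaces of an unreached face are degenerate, so its top degree is at most the degenerate
    mass above it. *)
Lemma mass_reached1 : mu A <= mu (reached 1) + c * mu degenerate :> R.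
Proof.
rewrite -natrM -natrD ler_nat.
have /(mass_sub d X)/leq_trans : A \subset reached 1 :|: (A :\: reached 1).
  by apply/subsetP => a aA; rewrite in_setU in_setD aA andbT orbN.
apply.
apply: (leq_trans (mass_setU _ _ _ _)); rewrite leq_add2l.
have DX : degenerate \subset X.
  by apply/subsetP => t; rewrite inE => /andP[/(subsetP (faces_subX X _))].
apply: leq_trans (sum_mass_above hX (A :\: reached 1) DX).
rewrite /mass; apply: leq_sum => a; rewrite in_setD => /andP[na aA].
have aK : #|a| = K by move: (subsetP hA a aA); rewrite in_faces => /andP[_ /eqP].
apply: (leq_trans (topdeg_le_cofaces hX aK Kd)); apply: mass_sub.
apply/subsetP => t /setIdP[tF at_]; apply/setIdP; split=> //.
exact: (unreached_coface hX hA cocycleA aA na tF at_).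
Qed.

Hypothesis small : P d * mu A < #|faces X d.+1|%:R.

(** A fat face of level [K] is empty and lies in all top faces, so its top degree alone would exceed
    the bound on the mass of [fat K]. *)
Lemma reached_top : reached K = set0.
Proof.
apply/setP => a; rewrite !inE; apply/negbTE/negP => /andP[_ /existsP[s /ladder_fat sF]].
have [_ sK] := fat_face hA sF; have s0 : s = set0 by apply/eqP; rewrite -cards_eq0; lia.
move: small; apply/negP; rewrite -leNgt.
apply: (@le_trans _ _ (P K * mu A)); last by rewrite ler_wpM2r // growth_le.
apply: le_trans (mass_fat K); rewrite ler_nat.
rewrite /mass (bigD1 s) //= s0; apply: leq_trans (leq_addr _ _).
by apply/subset_leq_card/subsetP => F FX; rewrite inE FX sub0set.
Qed.

Lemma mass_reached_gain j : (j < K)%N ->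
  mu (reached (K - j)) <= gain d beta j * mu degenerate.
Proof.
have c0 := subface_bound_gt0 R d; have c1 := subface_bound_ge1 R d.
elim: j => [|j IH] jK; first by rewrite subn0 reached_top /mass big_set0 mul0r.
have e : (K - j = (K - j.+1).+1)%N by lia.
have /mass_reached : (0 < K - j.+1 < K)%N by lia.
rewrite -e => h; have {}IH := IH (ltnW jK).
rewrite -(ler_pM2l beta0); apply: (le_trans h) => /=.
set m := mu (reached (K - j)) in IH *; set D := mu degenerate in IH *.
have D0 : 0 <= D by rewrite /D.
have -> : beta * (c ^+ 3 * (1 + beta^-1) * (1 + gain d beta j) * D) =
  (c ^+ 3 * (1 + beta)) * (D + gain d beta j * D).
  by field; rewrite gt_eqF.
have g0 : 0 <= gain d beta j * D by rewrite mulr_ge0 // gain_ge0.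
apply: (@le_trans _ _ (c ^+ 3 * (D + gain d beta j * D))); last first.
  rewrite ler_wpM2r ?addr_ge0 // ler_peMr ?exprn_ge0 ?lerDl //; exact: ltW.
rewrite [c ^+ 3]exprSr -[leRHS]mulrA ler_wpM2l ?exprn_ge0 ?(ltW c0) //.
rewrite mulrDr lerD //; first by rewrite ler_peMl.
by rewrite ler_wpM2l // ltW.
Qed.

Lemma small_locmin_cocycle_eq0 : A = set0.
Proof.
have c0 := subface_bound_gt0 R d; have c1 := subface_bound_ge1 R d.
have c3 : 0 < c ^+ 3 by rewrite exprn_gt0.
have D0 : 0 <= mu degenerate :> R by [].
have h : mu A <= gain d beta d * mu degenerate.
  apply: (@le_trans _ _ (gain d beta K * mu degenerate)); last by rewrite ler_wpM2r // gain_le.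
  apply: (le_trans mass_reached1).
  have := mass_reached_gain (_ : (K.-1 < K)%N); rewrite prednK // leqnn => /(_ isT).
  have -> : (K - K.-1 = 1)%N by lia.
  (* One further step of [gain] absorbs the term [c * mu degenerate]. *)
  move=> h1; rewrite -{3}(prednK K0) /=.
  apply: (le_trans (lerD h1 (lexx _))); rewrite -mulrDl ler_wpM2r //.
  have g0 := gain_ge0 d beta0 K.-1.
  have cc3 : c <= c ^+ 3 by rewrite exprS ler_peMr ?exprn_ege1 // ltW.
  have b0 : 0 < beta^-1 by rewrite invr_gt0.
  apply: (@le_trans _ _ (c ^+ 3 * (1 + gain d beta K.-1))); last first.
    by rewrite ler_wpM2r ?addr_ge0 // ler_peMr ?lerDl ?ltW.
  by rewrite mulrDr mulr1 addrC lerD // ler_peMl // exprn_ege1.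
apply: (mass_eq0 hX); first exact: subset_trans (faces_subX X K).
apply/eqP; rewrite -(pnatr_eq0 R) eq_le ler0n andbT.
rewrite leNgt; apply/negP => A0.
have := le_trans h (ler_wpM2l (gain_ge0 d beta0 d) mass_degenerate).
have := eta_small d beta0; rewrite -(ltr_pM2r A0) mul1r => /lt_le_trans/[apply].
apply/negP; rewrite -leNgt.
set g := gain _ _ _; set e := eta _ _.
by have -> : g * (8 * d%:R * c ^+ 3 * e * mu A) = 8 * d%:R * c ^+ 3 * g * e * mu A by ring.
Qed.

End Rigidity.

(** * Comparison of norm and mass; local minimality under bounded degree *)

Section Norm.
Variables (R : realFieldType) (V : finType) (d : nat) (X : {set {set V}}).
Hypothesis hX : is_dcomplex d X.
Implicit Types (s : {set V}) (g A B C : {set {set V}}).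

Lemma top_faces_gt0 : (0 < #|faces X d.+1|)%N.
Proof.
case: hX => X0 _ _ /(_ _ X0) [F FX _]; by apply/card_gt0P; exists F.
Qed.

Lemma norm_mass n A : A \subset faces X n ->
  norm R d X A = (mass d X A)%:R / ('C(d.+1, n) * #|faces X d.+1|)%:R.
Proof.
move=> /subsetP An; rewrite /norm /mass natr_sum big_distrl /=.
apply: eq_bigr => a /An; rewrite in_faces => /andP[_ /eqP aE].
by rewrite /weight aE.
Qed.

Lemma norm_le_mass n A : (n <= d.+1)%N -> A \subset faces X n ->
  norm R d X A * #|faces X d.+1|%:R <= (mass d X A)%:R.
Proof.
move=> nd /norm_mass ->; rewrite natrM invfM.
have f0 : 0 < #|faces X d.+1|%:R :> R by rewrite ltr0n top_faces_gt0.
have C0 : (0 < 'C(d.+1, n))%N by rewrite bin_gt0.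
rewrite mulrA divfK ?gt_eqF // ler_pdivrMr ?ltr0n //.
by rewrite ler_peMr // ler1n.
Qed.

Lemma mass_le_norm n A : (n <= d.+1)%N -> A \subset faces X n ->
  (mass d X A)%:R <= subface_bound R d * norm R d X A * #|faces X d.+1|%:R.
Proof.
move=> nd /norm_mass ->; rewrite natrM invfM.
have f0 : 0 < #|faces X d.+1|%:R :> R by rewrite ltr0n top_faces_gt0.
have C0 : 0 < ('C(d.+1, n))%:R :> R by rewrite ltr0n bin_gt0.
rewrite !mulrA divfK ?gt_eqF // ler_pdivlMr // mulrC ler_wpM2r //.
by rewrite ler_nat bin_le_exp2.
Qed.

Lemma norm_gt0 n A : (n <= d.+1)%N -> A \subset faces X n -> A != set0 ->
  0 < norm R d X A.
Proof.
move=> nd An A0.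
have f0 : 0 < #|faces X d.+1|%:R :> R by rewrite ltr0n top_faces_gt0.
have : 0 < (mass d X A)%:R :> R.
  rewrite ltr0n lt0n; apply: contra A0 => /eqP/(mass_eq0 hX) -> //.
  exact: subset_trans An (faces_subX _ _).
move=> /lt_le_trans /(_ (mass_le_norm nd An)).
by rewrite pmulr_lgt0 // pmulr_rgt0 // subface_bound_gt0.
Qed.

Lemma norm_le n A : (n <= d.+1)%N -> A \subset faces X n -> norm R d X A <= subface_bound R d.
Proof.
move=> nd An; have f0 : 0 < #|faces X d.+1|%:R :> R by rewrite ltr0n top_faces_gt0.
rewrite -(ler_pM2r f0); apply: (le_trans (norm_le_mass nd An)).
by rewrite -natrM ler_nat (mass_le hX).
Qed.

Lemma delta0 n : deltaS X n set0 = set0.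
Proof. by rewrite -{1}(symd_id set0) delta_symd symd_id. Qed.

(** All faces of [deltaS X K.-1 g] contain [s], so faces of [A] not above [s] are unchanged and the
    comparison takes place in the link of [s]. *)
Definition locally_minimal (K : nat) A : bool :=
  [forall s in X, (s != set0) ==> [forall g : {set {set V}},
    (above s g && (g \subset faces X K.-1)) ==>
    (mass d X A <= mass d X (symd A (deltaS X K.-1 g)))%N]].

Lemma locally_minimalP K A : reflect (forall s g, s \in X -> s != set0 -> above s g ->
    g \subset faces X K.-1 -> (mass d X A <= mass d X (symd A (deltaS X K.-1 g)))%N)
  (locally_minimal K A).
Proof.
apply: (iffP forall_inP) => [h s g sX s0 gs gK|h s sX].
  by have /implyP/(_ s0)/forallP/(_ g)/implyP := h s sX; apply; rewrite gs.
by apply/implyP => s0; apply/forallP => g; apply/implyP => /andP[]; apply: h.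
Qed.

Variable Q : nat.
Hypothesis hQ : forall v, v \in faces X 1 -> (#|link X v| <= Q)%N.

(** Removing one vertex [v] of [s] embeds [B] into the link of [v]. *)
Lemma card_above_le s B : s \in X -> s != set0 -> above s B -> B \subset X -> (#|B| <= Q)%N.
Proof.
move=> sX /set0Pn[v vs] sB /subsetP BX.
have vX : [set v] \in faces X 1.
  by rewrite in_faces cards1 eqxx andbT (face_sub hX sX) // sub1set.
have vB : above [set v] B.
  by apply/aboveP => b bB; rewrite sub1set; apply: (subsetP (aboveP _ _ sB b bB)).
rewrite -(card_in_imset (strip_injective vB)).
apply: leq_trans (hQ vX); apply/subset_leq_card/subsetP => t.
by rewrite in_strip // (in_link hX) => /andP[-> /BX].
Qed.

Lemma topdeg_leQ s : s \in X -> s != set0 -> (topdeg d X s <= Q)%N.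
Proof.
move=> sX s0; apply: (card_above_le sX s0).
  by apply/aboveP => F /setIdP[].
by apply/subsetP => F /setIdP[/(subsetP (faces_subX X _))].
Qed.

Lemma mass_leQ n C : C \subset faces X n.+1 -> (mass d X C <= #|C| * Q)%N.
Proof.
move=> /subsetP Cn; rewrite -sum_nat_const; apply: leq_sum => a /Cn.
rewrite in_faces => /andP[aX /eqP aE]; apply: topdeg_leQ => //.
by rewrite -card_gt0 aE.
Qed.

(* Every step that lowers the mass modifies at most [Q] faces. *)
Lemma local_reduction K B : B \subset faces X K.+1 ->
  exists C, [/\ C \subset faces X K, locally_minimal K.+1 (symd B (deltaS X K C)) &
    #|C| + Q * mass d X (symd B (deltaS X K C)) <= Q * mass d X B]%N.
Proof.
have [m] := ubnP (mass d X B); elim: m B => // m IH B Bm BK.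
have [lB|] := boolP (locally_minimal K.+1 B).
  exists set0; rewrite sub0set delta0 symd0 cards0; split=> //.
rewrite negb_forall_in => /existsP[s /andP[sX]].
rewrite negb_imply => /andP[s0 /forallPn[g]].
rewrite negb_imply -ltnNge => /andP[/andP[gs gK] lt].
have gQ : (#|g| <= Q)%N := card_above_le sX s0 gs (subset_trans gK (faces_subX _ _)).
have [|C [CK lC hC]] := IH _ _ (symd_faces BK (delta_sub X K g)).
  by apply: leq_trans lt _.
rewrite -symdA -delta_symd in lC hC.
exists (symd g C); split=> //; first exact: symd_faces.
have gC : (#|symd g C| <= #|g| + #|C|)%N.
  have := sum_symd (fun => 1%N) g C; rewrite !sum1_card => <-; exact: leq_addr.
apply: (@leq_trans (#|g| + (#|C| + Q * mass d X (symd B (deltaS X K (symd g C)))))).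
  by rewrite addnA leq_add2r.
apply: (@leq_trans (Q + Q * mass d X (symd B (deltaS X K g)))); first exact: leq_add.
by rewrite -mulnS leq_mul2l lt orbT.
Qed.

End Norm.

(** * The systolic and expansion bounds *)

Section Main.
Variables (R : realFieldType) (V : finType) (d : nat) (X : {set {set V}}) (beta : R).
Hypothesis hX : is_dcomplex d X.
Hypothesis beta0 : 0 < beta.
Hypothesis cob : forall s, s \in X -> (1 <= #|s|)%N -> (#|s|.+1 <= d)%N ->
  cob_expander (d - #|s|) (link X s) beta.
Hypothesis skel : forall s, s \in X -> (#|s|.+1 <= d)%N ->
  skel_expander (d - #|s|) (link X s) (threshold d beta d).

Local Notation c := (subface_bound R d).
Local Notation mu := ((c * growth d beta d)^-1).

Lemma mu_gt0 : 0 < mu.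
Proof. by rewrite invr_gt0 mulr_gt0 ?subface_bound_gt0 ?growth_gt0. Qed.

(** [B] is the given cochain of small norm, and [A] the one obtained from it by reducing mass. *)
Lemma small_locmin_eq0 K (A B : {set {set V}}) : (K < d)%N -> A \subset faces X K.+1 ->
  B \subset faces X K.+1 -> (mass d X A <= mass d X B)%N -> norm R d X B < mu ->
  locally_minimal d X K.+1 A -> deltaS X K.+1 A = set0 -> A = set0.
Proof.
move=> Kd AK BK AB Bmu /locally_minimalP lA dA.
apply: (small_locmin_cocycle_eq0 hX beta0 (ltn0Sn K) Kd AK skel cob lA dA).
have f0 : 0 < #|faces X d.+1|%:R :> R by rewrite ltr0n (top_faces_gt0 hX).
have Kd' : (K.+1 <= d.+1)%N by rewrite ltnS ltnW.
have c0 := subface_bound_gt0 R d; have g0 := growth_gt0 d beta0 d.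
apply: (@le_lt_trans _ _ (growth d beta d * (c * norm R d X B * #|faces X d.+1|%:R))).
  rewrite ler_pM2l //; apply: le_trans (mass_le_norm R hX Kd' BK).
  by rewrite ler_nat.
rewrite !mulrA -[ltRHS]mul1r ltr_pM2r // -mulrA mulrCA mulrA.
by move: Bmu; rewrite -[_^-1]mul1r ltr_pdivlMr ?mulr_gt0 // mulrC.
Qed.

Lemma systole_ge r : (r.+1 <= d)%N -> Syst_ge d X r mu.
Proof.
move=> rd z /andP[zr /eqP dz] ncob; rewrite leNgt; apply/negP => zmu.
pose w g := mass d X (symd z (deltaS X r g)).
case: (@arg_minnP _ set0 (fun g => g \subset faces X r) w (sub0set _)) => g gr gmin.
have Ar := symd_faces zr (delta_sub X r g).
have := gmin _ (sub0set _); rewrite /w delta0 symd0 => gz.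
have A0 : symd z (deltaS X r g) = set0.
  apply: (small_locmin_eq0 rd Ar zr gz zmu).
    (* A local correction [g'] only changes the primitive [g], so global minimality covers it. *)
    apply/locally_minimalP => s g' sX s0 gs g'r; rewrite -symdA -delta_symd.
    exact/gmin/symd_faces.
  by rewrite delta_symd dz (delta_delta hX) symd_id.
case/negP: ncob; apply/existsP; exists g; rewrite gr /=.
by rewrite (symd_eq0 A0).
Qed.

(** The first term of the minimum serves coboundaries of norm at least [mu], as distances never
    exceed [c]; the second serves small ones, which are corrected to zero. *)
Lemma cosystolic_expansion_ge Q k : (k.+2 <= d)%N ->
  (forall v, v \in faces X 1 -> (#|link X v| <= Q)%N) ->
  Exp_ge d X k (Num.min (mu / c) (c * (Q.+1 ^ 2)%:R)^-1).
Proof.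
move=> kd hQ A Ak nA.
have c0 := subface_bound_gt0 R d; have mu0 := mu_gt0.
have kd1 : (k.+1 <= d.+1)%N by rewrite ltnS ltnW // ltnW.
have kd2 : (k.+2 <= d.+1)%N by rewrite ltnW // ltnS.
have dist0 : 0 < distZ R d X k A.
  apply/bigmin_gtP; split.
    apply: (norm_gt0 R hX kd1 Ak); apply: contra nA => /eqP ->.
    by rewrite /cocycleb sub0set delta0 eqxx.
  move=> z zZ; have /andP[zk _] := zZ.
  apply: (norm_gt0 R hX kd1 (symd_faces Ak zk)); apply: contra nA => /eqP e.
  by rewrite (symd_eq0 e).
rewrite ler_pdivlMr //.
set B := deltaS X k.+1 A.
have Bk : B \subset faces X k.+2 := delta_sub _ _ _.
have nB0 : 0 <= norm R d X B.
  by apply: sumr_ge0 => a _; rewrite /weight divr_ge0.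
have [muB|Bmu] := leP mu (norm R d X B).
  apply: le_trans muB; apply: (@le_trans _ _ (mu / c * distZ R d X k A)).
    by rewrite ler_wpM2r ?(ltW dist0) // ge_min lexx.
  rewrite mulrAC ler_pdivrMr // ler_pM2l //.
  exact: le_trans (bigmin_le_id _ _ _ _) (norm_le R hX kd1 Ak).
(* [Q.+1] is positive even for [Q = 0], so it can be cancelled below. *)
have hQ' v : v \in faces X 1 -> (#|link X v| <= Q.+1)%N by move=> /hQ /leqW.
have [C [Ck lC hC]] := local_reduction hX hQ' Bk.
have B0 : symd B (deltaS X k.+1 C) = set0.
  apply: (small_locmin_eq0 kd _ Bk _ Bmu lC); first exact: symd_faces Bk (delta_sub _ _ _).
    have := leq_trans (leq_addl _ _) hC; by rewrite leq_pmul2l.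
  by rewrite delta_symd !(delta_delta hX) symd_id.
have zC : cocycleb X k (symd A C) by rewrite /cocycleb symd_faces //= delta_symd B0.
have : distZ R d X k A <= norm R d X C.
  apply: le_trans (bigmin_le_cond _ _ zC) _.
  by rewrite symdA symd_id (_ : symd set0 C = C) //; apply/setP => x; rewrite in_symd inE.
move=> dC; apply: (@le_trans _ _ ((c * (Q.+1 ^ 2)%:R)^-1 * norm R d X C)).
  apply: ler_pM => //; [apply: ltW|exact: ltW|by rewrite ge_min lexx orbT].
  by rewrite lt_min divr_gt0 //= invr_gt0 mulr_gt0 // ltr0n expn_gt0.
rewrite mulrC ler_pdivrMr; last by rewrite mulr_gt0 // ltr0n expn_gt0.
have f0 : 0 < #|faces X d.+1|%:R :> R by rewrite ltr0n (top_faces_gt0 hX).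
rewrite -(ler_pM2r f0); apply: (le_trans (norm_le_mass R hX kd1 Ck)).
(* One factor [Q.+1] bounds top degrees, the other bounds [#|C|] by the mass of [B]. *)
apply: (@le_trans _ _ ((Q.+1 ^ 2)%:R * (mass d X B)%:R)).
  rewrite -natrM ler_nat; apply: (leq_trans (mass_leQ hX hQ' Ck)).
  rewrite -mulnn -mulnA mulnC leq_pmul2l //.
  exact: leq_trans (leq_addr _ _) hC.
have -> : norm R d X B * (c * (Q.+1 ^ 2)%:R) * #|faces X d.+1|%:R =
  (Q.+1 ^ 2)%:R * (c * norm R d X B * #|faces X d.+1|%:R) by ring.
by rewrite ler_wpM2l // (mass_le_norm R hX kd2 Bk).
Qed.

End Main.

Theorem mainTheorem2 (R : realFieldType) (d : nat) (beta : R) :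
  0 < beta ->
  exists mu alpha : R, 0 < mu /\ 0 < alpha /\
  forall Q : nat, exists eps : R, 0 < eps /\
  forall (V : finType) (X : {set {set V}}),
    is_dcomplex d X ->
    (forall v, v \in faces X 1 -> (#|link X v| <= Q)%N) ->
    (forall sg, sg \in X -> (1 <= #|sg|)%N -> (#|sg|.+1 <= d)%N ->
        cob_expander (d - #|sg|) (link X sg) beta) ->
    (forall sg, sg \in X -> (#|sg|.+1 <= d)%N ->
        skel_expander (d - #|sg|) (link X sg) alpha) ->
    (forall k, (k.+2 <= d)%N -> Exp_ge d X k eps) /\
    (forall r, (r.+1 <= d)%N -> Syst_ge d X r mu).
Proof.
(* [alpha] is the threshold of level [d], the smallest among levels up to [d]. *)
move=> beta0; exists (subface_bound R d * growth d beta d)^-1, (threshold d beta d).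
have c0 := subface_bound_gt0 R d; have mu0 := mu_gt0 d beta0.
split=> //; split; first exact: threshold_gt0.
move=> Q; exists (Num.min ((subface_bound R d * growth d beta d)^-1 / subface_bound R d)
                         (subface_bound R d * (Q.+1 ^ 2)%:R)^-1).
split.
  by rewrite lt_min divr_gt0 //= invr_gt0 mulr_gt0 // ltr0n expn_gt0.
move=> V X hX hQ cob skel; split=> [k kd|r rd].
  exact: cosystolic_expansion_ge.
exact: systole_ge.
Qed.
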